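(* Let $G$ be a finite solvable group. If $G$ is a PNC-group, then $G$ is supersolvable.
   Context: For a subgroup $H$ of $G$, $H^G$ denotes the normal closure of $H$ in $G$. $H$ is an NC-subgroup of $G$ if $H^GN_G(H)=G$; $G$ is a PNC-group if every subgroup of $G$ is an NC-subgroup of $G$. *)

(* Defs.v *)
From HB Require Import structures.
From mathcomp Require Import all_boot all_fingroup all_solvable.

Set Implicit Arguments.
Unset Strict Implicit.
Unset Printing Implicit Defensive.

Local Open Scope group_scope.

Section Defs.

Variable gT : finGroupType.
Implicit Types (A B U V : {set gT}) (G H : {group gT}).

(* H^G is the subgroup generated by all G-conjugates of elements of H. *)
Definition normal_closure A B : {set gT} := <<class_support A B>>.

Definition NC_subgroup G H : Prop :=
  H \subset G /\ normal_closure H G * 'N_G(H) = G.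

Definition PNC_group G : Prop :=
  forall H, H \subset G -> NC_subgroup G H.

(* V and U are normal in the whole group A (not merely V normal in U), which
   is what separates supersolvability from solvability. *)
Definition cyclic_normal_factor A V U : bool :=
  [&& V <| A, U <| A, V \subset U & cyclic (U / V)].

Definition supersolvable G : Prop :=
  exists2 s : seq {group gT},
    (cyclic_normal_factor G).-series 1%G s & last 1%G s = G.

End Defs.

(* Main.v *)
(** Suppose [V] is normal in [G] and [U / V] is a nontrivial abelian normal
    subgroup of [G / V]. For [x] in [U] outside [V], the subgroup [H = <x>V] is
    normalised by [U], while its normal closure lies in [U]; so the NC condition
    on [H] forces [H] to be normal in [G]. Hence every proper normal subgroup
    [V] of [G] lies strictly below a normal subgroup [H] of [G] with [H / V]
    cyclic, and iterating from [V = 1] yields the series. *)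

Require Import Defs.
From HB Require Import structures.
From mathcomp Require Import all_boot all_fingroup all_solvable.

Set Implicit Arguments.
Unset Strict Implicit.
Unset Printing Implicit Defensive.

Local Open Scope group_scope.

Lemma NC_subgroup_normal (gT : finGroupType) (G U H : {group gT}) :
  NC_subgroup G H -> U <| G -> H <| U -> H <| G.
Proof.
case=> sHG defG nsUG /andP[sHU nHU]; rewrite /normal sHG -{1}defG mul_subG ?subsetIr //.
(* The factor ['N_G(H)] is done; the normal closure of [H] normalises [H] because it lies in [U]. *)
apply: subset_trans nHU; rewrite gen_subG.
exact: class_support_sub_norm sHU (normal_norm nsUG).
Qed.

Lemma PNC_cyclic_normal_step (gT : finGroupType) (G V : {group gT}) :
    solvable G -> PNC_group G -> V <| G -> V \proper G ->
  exists2 H : {group gT}, V \proper H & cyclic_normal_factor G V H.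
Proof.
move=> solG pncG nsVG /andP[sVG nsGV].
have ntGV : G / V != 1 by rewrite -subG1 quotient_sub1 ?normal_norm.
have [Ub [sUbG nsUb ntUb /abelem_abelian abUb]] :=
  solvable_norm_abelem (quotient_sol V solG) (normal_refl (G / V)) ntGV.
have [U defUb sVU nsUG] := inv_quotientN nsVG nsUb.
have sUG := normal_sub nsUG.
have nVU := subset_trans sUG (normal_norm nsVG).
have /subsetPn[x Ux notVx] : ~~ (U \subset V).
  by rewrite -quotient_sub1 // -defUb subG1.
have nVx : <[x]> \subset 'N(V) by rewrite cycle_subG (subsetP nVU).
pose H := (<[x]> <*> V)%G.
have sVH : V \subset H by rewrite joing_subr.
have sHU : H \subset U by rewrite join_subG cycle_subG Ux.
have nsVH : V <| H := normalS sVH (subset_trans sHU sUG) nsVG.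
have nsHU : H <| U.
  have nsVU : V <| U by apply/andP.
  (* Normality is lifted from [H / V], a subgroup of the abelian group [U / V]. *)
  rewrite -(quotientGK nsVH) -(quotientGK nsVU) cosetpre_normal.
  by rewrite -defUb -sub_abelian_normal // defUb quotientS.
have nsHG : H <| G.
  by apply: NC_subgroup_normal nsUG nsHU; apply: pncG; apply: subset_trans sUG.
exists H.
  apply/andP; split=> //; apply: contra notVx => /subsetP; apply.
  by rewrite mem_gen // inE cycle_id.
by rewrite /cyclic_normal_factor nsVG nsHG sVH quotientYidr // quotient_cyclic ?cycle_cyclic.
Qed.

(** A variable starting point [V] lets the induction prepend one factor at a time. *)
Lemma PNC_cyclic_normal_series (gT : finGroupType) (G V : {group gT}) :
    solvable G -> PNC_group G -> V <| G ->
  exists2 s : seq {group gT},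
    (cyclic_normal_factor G).-series V s & last V s = G.
Proof.
move=> solG pncG; have [n] := ubnP (#|G| - #|V|).
elim: n V => // n IHn V; rewrite ltnS => leVn nsVG.
have [/val_inj-> | prVG] := eqVproper (normal_sub nsVG); first by exists [::].
have [H prVH cfH] := PNC_cyclic_normal_step solG pncG nsVG prVG.
have /and4P[_ nsHG _ _] := cfH.
have [|s sP lastG] := IHn H _ nsHG.
  (* Subtraction is truncated, so strict decrease needs #|V| < #|G| as well as #|V| < #|H|. *)
  apply: leq_trans leVn; apply: ltn_sub2l; exact: proper_card.
by exists (H :: s) => //=; rewrite cfH.
Qed.

Theorem proposition2p3 (gT : finGroupType) (G : {group gT})
  (solG : solvable G) (pncG : PNC_group G) : supersolvable G.
Proof. exact: PNC_cyclic_normal_series (normal1 G). Qed.
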